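(* Let $G$ be an Eulerian planar triangulation with planar dual $G^*$, whose vertices are properly coloured blue, red and green (adjacent vertices receive different colours). Suppose that every cycle of $G$ all of whose vertices are red or green contains a vertex whose degree in $G$ is $4$. Then $G^*$ is Hamiltonian, that is, $G^*$ has a cycle passing through every vertex of $G^*$.
   Context: A planar triangulation is a finite simple graph with at least $4$ vertices, embedded in the plane (equivalently the sphere), in which every face, including the outer face, is bounded by a $3$-cycle. It is Eulerian if every vertex has even degree. Its planar dual $G^*$ has one vertex for each face of $G$ (including the outer face), and for each edge $e$ of $G$ an edge joining the two faces incident to $e$; it is a cubic $3$-connected planar graph. ''Cycle of $G$'' means any cycle in $G$ as a subgraph (not necessarily induced or facial). *)

(* Defs.v *)
From HB Require Import structures.
From mathcomp Require Import all_boot all_fingroup.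

Set Implicit Arguments.
Unset Strict Implicit.
Unset Printing Implicit Defensive.

Record sgraph := SGraph {
  vertex :> finType;
  adj : rel vertex;
  adj_sym : symmetric adj;
  adj_irr : irreflexive adj
}.

Definition deg (G : sgraph) (x : G) : nat := #|[set y | adj x y]|.

(* A cycle, as the cyclic list of its vertices. *)
Definition is_cycle (T : eqType) (e : rel T) (s : seq T) : bool :=
  (2 < size s) && ucycleb e s.

Definition hamiltonian (T : finType) (e : rel T) : Prop :=
  exists2 s : seq T, is_cycle e s & forall x : T, x \in s.

(* Embeddings in the sphere are encoded by rotation systems. A dart is an     *)
(* oriented edge, written as the pair (source, target).                       *)
Definition dart (G : sgraph) : finType := {d : G * G | adj d.1 d.2}.

Definition src (G : sgraph) (d : dart G) : G := (val d).1.

Fact rev_subproof (G : sgraph) (d : dart G) : adj (val d).2 (val d).1.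
Proof. by rewrite adj_sym (valP d). Qed.

Definition rev (G : sgraph) (d : dart G) : dart G :=
  Sub ((val d).2, (val d).1) (rev_subproof d).

Lemma revK (G : sgraph) : involutive (@rev G).
Proof. by case=> [[x y] e]; apply: val_inj. Qed.

Definition rev_perm (G : sgraph) : {perm dart G} := perm (inv_inj (@revK G)).

(* r turns each dart into the next one around its source, so its orbits are   *)
(* exactly the sets of all darts with a given source.                         *)
Definition rotation (G : sgraph) (r : {perm dart G}) : Prop :=
  forall d d' : dart G, (d' \in porbit r d) = (src d == src d').

(* The facial walk after a dart (x, y) continues with r (y, x), the successor *)
(* of (y, x) around y; products of permutations are read from left to right.  *)
Definition face_perm (G : sgraph) (r : {perm dart G}) : {perm dart G} :=
  (rev_perm G * r)%g.

Definition face (G : sgraph) (r : {perm dart G}) : finType :=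
  {A : {set dart G} | A \in porbits (face_perm r)}.

(* The vertices met, in order, along the boundary of the face containing d. *)
Definition face_boundary (G : sgraph) (r : {perm dart G}) (d : dart G) : seq G :=
  [seq src d' | d' <- traject (face_perm r) d #|porbit (face_perm r) d|].

(* A rotation system of a connected graph describes a cellular embedding in   *)
(* an orientable surface; by Euler's formula that surface is the sphere iff   *)
(* V + F = E + 2. Each edge carries two darts.                                *)
Definition sphere_embedding (G : sgraph) (r : {perm dart G}) : Prop :=
  [/\ rotation r,
      forall x y : G, connect (@adj G) x y
    & #|G| + #|face r| = #|dart G|./2 + 2].

(* Connectedness, part of sphere_embedding, is no restriction here: a plane   *)
(* graph all of whose faces are bounded by cycles is connected.               *)
Definition planar_triangulation (G : sgraph) (r : {perm dart G}) : Prop :=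
  [/\ 3 < #|G|,
      sphere_embedding r
    & forall d : dart G, is_cycle (@adj G) (face_boundary r d)
                         /\ size (face_boundary r d) = 3].

Definition eulerian (G : sgraph) : Prop := forall x : G, ~~ odd (deg x).

(* Adjacency in the planar dual: the edge carrying d separates the face       *)
(* containing d from the face containing rev d. Multiplicities of dual edges  *)
(* are dropped; they are irrelevant to cycles of length at least 3.           *)
Definition dual_adj (G : sgraph) (r : {perm dart G}) : rel (face r) :=
  fun A B => [exists d : dart G, (d \in val A) && (rev d \in val B)].

Inductive colour := Blue | Red | Green.

Definition proper_colouring (G : sgraph) (c : G -> colour) : Prop :=
  forall x y : G, adj x y -> c x <> c y.

(* Main.v *)
Require Import Defs.
From mathcomp Require Import all_boot all_fingroup.
From mathcomp Require Import zify.

Set Implicit Arguments.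
Unset Strict Implicit.
Unset Printing Implicit Defensive.

(* Take a minimal set B of red and green vertices that induces a connected    *)
(* subgraph and meets every red-green edge. If B contained a cycle, a vertex  *)
(* of degree 4 on it, whose only two non-blue neighbours are its neighbours   *)
(* on the cycle, could be removed from B; hence B induces a tree. Every face  *)
(* has a blue corner, outside B, and a corner in B, so exactly one of its     *)
(* sides is an edge leaving B and exactly one is an edge entering B. Walking  *)
(* around the tree meets all edges leaving B in one cyclic order, in which    *)
(* consecutive edges lie on a common face: this is a Hamiltonian cycle of the *)
(* dual.                                                                      *)

(** A closed curve drawn closely around an induced tree that crosses each triangle exactly once is a
    Hamiltonian cycle of the dual. [one_contour_tree] shows that the boundary of an induced tree is
    a single closed walk, and [hamiltonian_cut] turns that walk into the dual cycle. It remains to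
    find the tree. [nonblue_connected] makes the set of all red and green vertices a starting point.
    Around a red vertex the neighbours alternate between green and blue (symmetrically for green),
    so by [nonblue_neighbours] a degree-4 vertex has at most two non-blue neighbours. If it lies on
    a cycle inside [B], these are its neighbours on the cycle, so they are in [B]: deleting the
    vertex keeps [B] connected ([connected_set_remove]) and every red-green edge covered, against
    minimality. *)

Definition tgt (G : sgraph) (d : dart G) : G := (val d).2.

Section Darts.

Variable G : sgraph.
Implicit Types d : dart G.

Lemma adj_dart d : adj (src d) (tgt d).
Proof. exact: valP d. Qed.

Lemma dart_of_adj (x y : G) :
  adj x y -> exists d : dart G, src d = x /\ tgt d = y.
Proof. by move=> xy; exists (Sub (x, y) xy). Qed.

Lemma dart_inj d d' : src d = src d' -> tgt d = tgt d' -> d = d'.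
Proof.
case: d d' => [[x y] xy] [[x' y'] xy'] /= s t; apply: val_inj => /=.
by move: s t; rewrite /src /tgt /= => -> ->.
Qed.

Lemma tgt_neq_src d : tgt d != src d.
Proof. by apply: contraTneq (adj_dart d) => ->; rewrite adj_irr. Qed.

Lemma src_rev d : src (Defs.rev d) = tgt d. Proof. by []. Qed.
Lemma tgt_rev d : tgt (Defs.rev d) = src d. Proof. by []. Qed.

End Darts.

(** * Rotation systems: turning around a vertex and walking along a face *)

Section Rotation.

Variables (G : sgraph) (r : {perm dart G}).
Hypothesis rot_r : rotation r.
Implicit Types d : dart G.

Lemma src_rot d : src (r d) = src d.
Proof.
by apply/esym/eqP; rewrite -(rot_r d (r d)) -[r d]/(aperm d r) (mem_porbit r 1 d).
Qed.

Lemma src_iter_rot n d : src (iter n r d) = src d.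
Proof. by elim: n => //= n IHn; rewrite src_rot. Qed.

Lemma same_src_iter d d' : src d = src d' -> exists n, d' = iter n r d.
Proof.
by move/eqP; rewrite -rot_r => /porbitP[n ->]; exists n; rewrite permX.
Qed.

Lemma face_permE d : face_perm r d = r (Defs.rev d).
Proof. by rewrite permM permE. Qed.

Lemma src_face_perm d : src (face_perm r d) = tgt d.
Proof. by rewrite face_permE src_rot. Qed.

Lemma face_perm_rev d : face_perm r (Defs.rev d) = r d.
Proof. by rewrite face_permE Defs.revK. Qed.

End Rotation.

(** * The closed walk around an induced tree *)

Section TreeBoundary.

Variables (G : sgraph) (r : {perm dart G}).
Hypothesis rot_r : rotation r.
Implicit Types (d : dart G) (T : {set G}).

(* One step of the walk around the subgraph induced by T, drawn with its      *)
(* pending edges: edges inside T are followed, all others are turned past.    *)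
Definition contour T d : dart G := if tgt d \in T then face_perm r d else r d.

(** The boundary of a thin neighbourhood of the subgraph induced by [T] is one closed curve, as it
    is for a tree. *)
Definition one_contour T : Prop :=
  forall d d', src d \in T -> src d' \in T -> fconnect (contour T) d d'.

Lemma src_contour T d : src d \in T -> src (contour T d) \in T.
Proof.
by rewrite /contour; case: ifP => [Td _|_]; rewrite ?src_face_perm ?src_rot.
Qed.

(** Without loops no edge stays inside a single vertex, so the contour is the rotation at [x]. *)
Lemma one_contour1 x : one_contour [set x].
Proof.
move=> d d' /set1P dx /set1P d'x.
have [n ->] : exists n, d' = iter n r d.
  by apply: (same_src_iter rot_r); rewrite dx d'x.
elim: n => [|n IHn]; first exact: connect0.
apply: connect_trans IHn _; rewrite iterS.
have <- : contour [set x] (iter n r d) = r (iter n r d).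
  rewrite /contour in_set1 ifN //.
  by rewrite -dx -(src_iter_rot rot_r n d) tgt_neq_src.
exact: fconnect1.
Qed.

(* Attaching the leaf y through the dart e from T to y inserts the darts      *)
(* around y between e and r e in the contour.                                 *)
Lemma one_contour_leaf T x y : x \in T -> y \notin T -> adj x y ->
  (forall z, z \in T -> adj z y -> z = x) ->
  one_contour T -> one_contour (y |: T).
Proof.
move=> Tx T'y xy unique_x contour_T; set T' := y |: T.
have [e [ex ey]] := dart_of_adj xy.
have contour_e : contour T' e = r (Defs.rev e).
  by rewrite /contour ey setU11 face_permE.
have contour_re : contour T' (Defs.rev e) = r e.
  by rewrite /contour tgt_rev ex inE Tx orbT face_perm_rev.
(* As [x] is the only neighbour of [y] in [T], every dart at [y] other than [rev e] is pending and
   is turned past. *)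
have contour_y d : src d = y -> d != Defs.rev e -> contour T' d = r d.
  move=> dy ne; rewrite /contour ifN // !inE negb_or -{1}dy tgt_neq_src /=.
  apply: contraNN ne => Td; apply/eqP/dart_inj; first by rewrite dy src_rev.
  by rewrite tgt_rev ex; apply: unique_x Td _; rewrite adj_sym -dy adj_dart.
have to_re d : src d = y -> fconnect (contour T') d (Defs.rev e).
  move=> dy; have [n] : exists n, Defs.rev e = iter n r d.
    by apply: (same_src_iter rot_r); rewrite dy src_rev.
  elim: n d dy => [|n IHn] d dy; first by move=> ->; apply: connect0.
  have [-> _|ne] := eqVneq d (Defs.rev e); first exact: connect0.
  rewrite iterSr => /IHn; rewrite src_rot // => /(_ dy).
  by apply: connect_trans; rewrite -contour_y ?fconnect1.
have from_e d : src d = y -> fconnect (contour T') e d.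
  move=> dy; have [|n ->] := @same_src_iter _ _ rot_r (r (Defs.rev e)) d.
    by rewrite src_rot // src_rev ey.
  elim: n => [|n IHn]; first by rewrite -contour_e fconnect1.
  rewrite iterS; set w := iter n _ _ in IHn *.
  have wy : src w = y by rewrite src_iter_rot // src_rot // src_rev ey.
  have [->|ne] := eqVneq w (Defs.rev e); first by rewrite -contour_e fconnect1.
  by apply: connect_trans IHn _; rewrite -contour_y ?fconnect1.
(* Only the old step from [e] to [r e] changes: it becomes the detour from [e] around [y] to
   [rev e], and then to [r e]. *)
have T_step d : src d \in T -> fconnect (contour T') d (contour T d).
  move=> Td; have [->|ne] := eqVneq d e.
    rewrite {2}/contour ey (negPf T'y).
    apply: connect_trans (from_e (Defs.rev e) _) _ => //.
    by rewrite -contour_re fconnect1.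
  rewrite (_ : contour T d = contour T' d) ?fconnect1 // /contour !inE.
  case: eqP => //= dy; case/eqP: ne; apply: dart_inj; last by rewrite ey.
  by rewrite ex; apply: unique_x Td _; rewrite -dy adj_dart.
have TT d d' : src d \in T -> src d' \in T -> fconnect (contour T') d d'.
  move=> Td Td'; have /iter_findex <- := contour_T d d' Td Td'.
  move: (findex _ d d') => n; elim: n d Td => [|n IHn] d Td; first exact: connect0.
  rewrite iterSr; apply: connect_trans (T_step d Td) _.
  by apply: IHn; apply: src_contour.
have Te : src e \in T by rewrite ex.
have Tre : src (r e) \in T by rewrite src_rot.
have out_y d : src d \in T' ->
    exists2 d1, src d1 \in T & fconnect (contour T') d d1.
  rewrite inE => /orP[/set1P dy|Td]; last by exists d; rewrite ?connect0.
  exists (r e) => //; apply: connect_trans (to_re d dy) _.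
  by rewrite -contour_re fconnect1.
have in_y d : src d \in T' ->
    exists2 d1, src d1 \in T & fconnect (contour T') d1 d.
  rewrite inE => /orP[/set1P dy|Td]; last by exists d; rewrite ?connect0.
  by exists e => //; apply: from_e.
move=> d d' /out_y[d1 Td1 dd1] /in_y[d2 Td2 dd2].
exact: connect_trans dd1 (connect_trans (TT _ _ Td1 Td2) dd2).
Qed.

End TreeBoundary.

(** * Connected and acyclic induced subgraphs *)

Section InducedSubgraphs.

Variable G : sgraph.
Implicit Types (B C T : {set G}) (x y z u v : G).

Definition induced B : rel G := [rel u v | [&& u \in B, v \in B & adj u v]].

Definition connected_set B : Prop :=
  {in B &, forall u v, connect (induced B) u v}.

Lemma connected_setP B :
  reflect (connected_set B)
    [forall u in B, forall v in B, connect (induced B) u v].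
Proof.
apply: (iffP forall_inP) => [con u v Bu Bv|con u Bu].
  exact: forall_inP (con u Bu) v Bv.
by apply/forall_inP=> v Bv; apply: con.
Qed.

Definition acyclic_set B : Prop :=
  forall s : seq G, is_cycle (@adj G) s -> ~ {subset s <= B}.

Lemma induced_connect_sym B : connect_sym (induced B).
Proof.
by apply: sym_connect_sym => u v; rewrite /induced /= adj_sym andbA [_ && (v \in B)]andbC -andbA.
Qed.

Lemma path_induced B x p : path (induced B) x p ->
  path (@adj G) x p /\ {subset p <= B}.
Proof.
elim: p x => //= y p IHp x /andP[/and3P[_ By xy] /IHp[yp pB]].
by rewrite xy; split=> // z /predU1P[->|/pB].
Qed.

Lemma induced_path B x p : path (@adj G) x p -> {subset x :: p <= B} ->
  path (induced B) x p.
Proof.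
elim: p x => //= y p IHp x /andP[xy yp] xpB.
apply/andP; split.
  by apply/and3P; split=> //; apply: xpB; rewrite !inE eqxx ?orbT.
by apply: IHp => // z zp; apply: xpB; rewrite inE zp orbT.
Qed.

(** Supplies the next leaf of the spanning tree: a path of [B] from [x] to [v] has to leave [T]. *)
Lemma induced_boundary B T x v : x \in T -> T \subset B -> connected_set B ->
  v \in B -> v \notin T ->
  exists x' y, [/\ x' \in T, y \in B :\: T & adj x' y].
Proof.
move=> Tx sTB conB Bv T'v.
have /connectP[p] := conB _ _ (subsetP sTB _ Tx) Bv.
elim: p x Tx => [|y p IHp] x Tx /=; first by move=> _ vx; rewrite vx Tx in T'v.
case/andP=> /and3P[_ By xy] yp vp; have [Ty|T'y] := boolP (y \in T).
  exact: IHp Ty yp vp.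
by exists x, y; rewrite inE T'y By.
Qed.

Lemma connected_setU1 B x y : x \in B -> adj x y -> connected_set B ->
  connected_set (y |: B).
Proof.
move=> Bx xy conB.
have toB u : u \in y |: B -> connect (induced (y |: B)) u x.
  case/setU1P=> [->|Bu].
    by apply: connect1; rewrite /induced /= !inE eqxx Bx orbT adj_sym.
  apply: connect_sub (conB _ _ Bu Bx) => v w /and3P[Bv Bw vw].
  by apply: connect1; rewrite /induced /= !inE Bv Bw !orbT.
move=> u v /toB ux /toB; rewrite induced_connect_sym; exact: connect_trans.
Qed.

(** A second neighbour [z] would close a simple path of [T] from [x] to [z] into a cycle of [B]
    through [y]. *)
Lemma tree_attachment_unique B T x y z : acyclic_set B -> T \subset B ->
  connected_set T -> y \in B -> y \notin T -> x \in T -> z \in T ->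
  adj x y -> adj z y -> z = x.
Proof.
move=> acB sTB conT By T'y Tx Tz xy zy; apply/eqP/negP=> /negP ne.
have /connectP[p0 p0P def_z] := conT _ _ Tx Tz; move: ne zy; rewrite {}def_z.
have [p pP p_uniq _] := shortenP p0P => ne zy.
have [p_adj pT] := path_induced pP.
have xpT : {subset x :: p <= T} by move=> w /predU1P[->|/pT].
apply: (acB [:: y, x & p]) => [|w /predU1P[->|/xpT/(subsetP sTB)] //].
rewrite /is_cycle /ucycleb; apply/and3P; split.
- by case: p ne {pP p_uniq zy p_adj pT xpT} => //=; rewrite eqxx.
- by rewrite /= rcons_path p_adj adj_sym xy zy.
- by rewrite cons_uniq p_uniq andbT; apply: contraNN T'y => /xpT.
Qed.

(* A degree-two vertex x on a cycle can be bypassed along the cycle. *)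
Lemma connected_set_remove B C (s : seq G) x : connected_set B -> B \subset C ->
  is_cycle (@adj G) s -> {subset s <= B} -> x \in s ->
  #|[set w in C | adj x w]| <= 2 ->
  [set w in C | adj x w] \subset s /\ connected_set (B :\ x).
Proof.
move=> conB /subsetP sBC /andP[s_gt2 /andP[s_cyc s_uniq]] sB sx deg_x.
have [i p def_s] := rot_to sx.
have size_p : 1 < size p by rewrite -(size_rot i) def_s in s_gt2.
have mem_p : {subset x :: p <= s} by move=> w; rewrite -def_s mem_rot.
have: path.cycle (@adj G) (x :: p) && uniq (x :: p).
  by rewrite -def_s rot_cycle rot_uniq s_cyc.
case: p size_p mem_p {def_s} => [|y [|y1 q]] // _ mem_p.
rewrite /path.cycle rcons_path => /andP[/andP[/andP[xy yq] zx]].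
rewrite -/(path _ _ _) cons_uniq => /andP[x'p] /andP[y'q _].
set z := last y1 q in zx; have qz : z \in y1 :: q by apply: mem_last.
have pz : z \in y :: y1 :: q by rewrite inE qz orbT.
have yz : connect (induced (B :\ x)) y z.
  apply/connectP; exists (y1 :: q) => //; apply: induced_path => // w pw.
  rewrite !inE (sB w) ?mem_p 1?inE ?pw ?orbT // andbT.
  by apply: contraNneq x'p => <-.
(* The two cycle neighbours [y] and [z] of [x] are distinct and already exhaust the degree bound. *)
have def_N : [set w in C | adj x w] = [set y; z].
  apply/esym/eqP; rewrite eqEcard cards2.
  rewrite (_ : y != z) ?deg_x ?andbT; last by apply: contraNneq y'q => ->.
  apply/subsetP=> w; rewrite !inE => /orP[]/eqP->.
    by rewrite xy sBC // sB // mem_p // !inE eqxx orbT.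
  by rewrite adj_sym zx sBC // sB // mem_p // inE pz orbT.
rewrite def_N; split.
  apply/subsetP=> w; rewrite !inE => /orP[]/eqP->; apply: mem_p.
    by rewrite !inE eqxx orbT.
  by rewrite inE pz orbT.
have yN w : w \in B -> adj x w -> connect (induced (B :\ x)) y w.
  move=> Bw xw; have: w \in [set y; z] by rewrite -def_N inE sBC.
  by rewrite !inE => /orP[]/eqP->.
(* Each visit of the walk to [x] is replaced by [y], from which every neighbour of [x] in [B] can be
   reached while avoiding [x]. *)
have detour p w : path (induced B) w p -> last w p != x ->
    connect (induced (B :\ x)) (if w == x then y else w) (last w p).
  elim: p w => [|w' p IHp] w /=; first by move=> _ /negPf->.
  case/andP=> /and3P[Bw Bw' ww'] w'p /(IHp _ w'p); apply: connect_trans.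
  have [eqx|nex] := eqVneq w x; have [eqx'|nex'] := eqVneq w' x.
  - exact: connect0.
  - by apply: yN; rewrite // -eqx.
  - by rewrite induced_connect_sym yN // adj_sym -eqx'.
  - by apply: connect1; rewrite /induced /= !inE nex nex' Bw Bw'.
move=> u v /setD1P[ux Bu] /setD1P[vx Bv].
have /connectP[p uP def_v] := conB _ _ Bu Bv.
by have := detour p u uP; rewrite -def_v (negPf ux); apply.
Qed.

End InducedSubgraphs.

(* A spanning tree of B is grown leaf by leaf; in an acyclic induced subgraph *)
(* a new vertex has only one neighbour in the tree built so far.              *)
Lemma one_contour_tree (G : sgraph) (r : {perm dart G}) (B : {set G}) :
  rotation r -> connected_set B -> acyclic_set B -> one_contour r B.
Proof.
move=> rot_r conB acB; have [->|[x Bx]] := set_0Vmem B.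
  by move=> d d'; rewrite inE.
suff grow n : n <= #|B| ->
    exists T : {set G}, [/\ x \in T, T \subset B, connected_set T,
                            one_contour r T & n <= #|T|].
  have [T [_ sTB _ contour_T leBT]] := grow _ (leqnn _).
  by have /eqP<- : T == B by rewrite eqEcard sTB.
elim: n => [_|n IHn lt_nB].
  exists [set x]; rewrite set11 sub1set Bx; split=> //; last exact: one_contour1.
  by move=> u v /set1P-> /set1P->; apply: connect0.
have [T [Tx sTB conT contour_T le_nT]] := IHn (ltnW lt_nB).
have [lt_nT|le_Tn] := ltnP n #|T|; first by exists T.
have [v Bv T'v] : exists2 v, v \in B & v \notin T.
  apply/subsetPn; apply: contraL lt_nB => /subset_leq_card le_BT.
  by rewrite -leqNgt (leq_trans le_BT).
have [x' [y [Tx' /setDP[By T'y] x'y]]] := induced_boundary Tx sTB conB Bv T'v.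
exists (y |: T); rewrite setU1r // cardsU1 T'y; split=> //.
- by rewrite subUset sub1set By.
- exact: connected_setU1 x'y conT.
- apply: (one_contour_leaf rot_r Tx' T'y x'y _ contour_T) => z Tz.
  exact: tree_attachment_unique acB sTB conT By T'y Tx' Tz x'y.
Qed.

(** * Triangular faces and Euler's formula *)

Section Triangulation.

Variables (G : sgraph) (r : {perm dart G}).
Hypothesis rot_r : rotation r.
Hypothesis tri_r : forall d, size (face_boundary r d) = 3.
Implicit Types d : dart G.

Local Notation phi := (face_perm r).

Lemma card_face d : #|porbit phi d| = 3.
Proof. by have := tri_r d; rewrite size_map size_traject. Qed.

Lemma face_perm3 d : phi (phi (phi d)) = d.
Proof. by have := iter_porbit phi d; rewrite card_face. Qed.

Lemma mem_face d d' : (d' \in porbit phi d) = (d' \in [:: d; phi d; phi (phi d)]).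
Proof. by rewrite porbit_traject card_face. Qed.

Lemma tgt_face2 d : tgt (phi (phi d)) = src d.
Proof. by rewrite -(src_face_perm rot_r) face_perm3. Qed.

(** The triangle through [rev d] consists of [rev d], [r d] and [phi (r d)], so consecutive darts at
    a vertex span a face. *)
Lemma tgt_face_rot d : tgt (phi (r d)) = tgt d.
Proof. by rewrite -(face_perm_rev r) tgt_face2. Qed.

Lemma adj_tgt_rot d : adj (tgt (r d)) (tgt d).
Proof. by rewrite -(src_face_perm rot_r) -tgt_face_rot adj_dart. Qed.

Lemma adj_src_tgt_face d : adj (tgt (phi d)) (src d).
Proof. by rewrite -(src_face_perm rot_r) -(tgt_face2 d) adj_dart. Qed.

Lemma card_darts : #|dart G| = #|face r| * 3.
Proof.
rewrite (card_sig (fun A => A \in porbits phi)) -sum_nat_const -sum1_card.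
rewrite (partition_big (porbit phi) (mem (porbits phi))) /= => [|d _];
  last exact: imset_f.
apply: eq_big => // A /imsetP[d _ ->].
rewrite sum1_card -[RHS](card_face d); apply: eq_card => d'.
by rewrite -eq_porbit_mem.
Qed.

(** There are 3F darts, so Euler's formula gives floor(F/2) = V - 2 >= 2. This provides the length
    required of a cycle in the dual. *)
Lemma two_lt_faces : 3 < #|G| -> #|G| + #|face r| = #|dart G|./2 + 2 ->
  2 < #|face r|.
Proof.
move=> G_gt3; rewrite card_darts; move: #|G| G_gt3 #|face r| => [|[|[|[|n]]]] //= _.
by case=> [|[|[|f]]] //; lia.
Qed.

(** * From the contour of [B] to a Hamiltonian cycle of the dual *)

Section CutCycle.

Variable B : {set G}.
Hypothesis meet_B :
  forall d, [|| src d \in B, tgt d \in B | tgt (phi d) \in B].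
Hypothesis meet_BC :
  forall d, [|| src d \notin B, tgt d \notin B | tgt (phi d) \notin B].
Hypothesis contour_B : one_contour r B.

Definition cut_dart d := (src d \in B) && (tgt d \notin B).

(** The first return of the contour walk to a cut dart. If [r d] stays inside [B], the walk follows
    it to [phi (r d)], which ends at [tgt d] outside [B] and so is a cut dart. *)
Definition next_cut d := if cut_dart (r d) then r d else phi (r d).

Lemma next_cutP d : cut_dart d ->
  cut_dart (next_cut d) /\ next_cut d \in porbit phi (Defs.rev d).
Proof.
case/andP=> Bd B'd; rewrite /next_cut mem_face; case: ifP => [-> | ncut].
  by rewrite !inE -(face_perm_rev r) eqxx orbT.
rewrite /cut_dart tgt_face_rot (src_face_perm rot_r) B'd.
rewrite -(face_perm_rev r d) !inE eqxx !orbT; split=> //.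
by move/negbT: ncut; rewrite /cut_dart src_rot // Bd /= negbK andbT face_perm_rev.
Qed.

(** A closed walk of length 3 enters [B] at most once: the side after an entry starts in [B], and
    the side before it ends outside [B]. *)
Lemma rev_cut_unique d d' : cut_dart d -> cut_dart d' ->
  Defs.rev d' \in porbit phi (Defs.rev d) -> d' = d.
Proof.
case/andP=> Bd B'd /andP[Bd' B'd']; rewrite mem_face !inE.
case/or3P=> /eqP rd'.
- by apply: (inv_inj (@Defs.revK G)).
- by case/negP: B'd'; rewrite -src_rev rd' (src_face_perm rot_r).
- by case/negP: B'd; rewrite -src_rev -tgt_face2 -rd'.
Qed.

(** A triangle with corners on both sides must enter [B] somewhere. With [rev_cut_unique] this
    matches faces with cut darts. *)
Lemma face_has_cut d : exists2 e, cut_dart e & Defs.rev e \in porbit phi d.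
Proof.
suff [e [fe B'e Be]] :
  exists e, [/\ e \in porbit phi d, src e \notin B & tgt e \in B].
  by exists (Defs.rev e); rewrite /cut_dart ?src_rev ?tgt_rev ?Be ?Defs.revK.
have [d1 d2 d3] : [/\ d \in porbit phi d, phi d \in porbit phi d
                    & phi (phi d) \in porbit phi d].
  by rewrite !mem_face !inE !eqxx !orbT.
have := meet_B d; have := meet_BC d.
have [Ba|B'a] := boolP (src d \in B); have [Bb|B'b] := boolP (tgt d \in B);
  have [Bc|B'c] := boolP (tgt (phi d) \in B) => //= _ _.
- by exists (phi (phi d)); rewrite tgt_face2 (src_face_perm rot_r).
- by exists (phi d); rewrite (src_face_perm rot_r).
- by exists (phi (phi d)); rewrite tgt_face2 (src_face_perm rot_r).
- by exists d.
- by exists d.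
- by exists (phi d); rewrite (src_face_perm rot_r).
Qed.

Lemma next_cut_connect d d' :
  cut_dart d -> cut_dart d' -> fconnect next_cut d d'.
Proof.
move=> cd cd'; have /iter_findex : fconnect (contour r B) d d'.
  by apply: contour_B; [case/andP: cd | case/andP: cd'].
(* Strong induction on the number of contour steps, because one step of [next_cut] may use up two of
   them. *)
move: (findex _ _ _) => n; elim/ltn_ind: n d cd => -[|n] IHn d cd.
  by move=> /= ->; apply: connect0.
have [Bd B'd] := andP cd.
rewrite iterSr {2}/contour (negPf B'd) => itn.
have [cnd _] := next_cutP cd; apply: connect_trans (fconnect1 _ _) _.
move: cnd; rewrite /next_cut; case: ifP => [_ crd|ncr cnd].
  exact: IHn itn.
(* The contour cannot stop at [r d], which is not a cut dart while [d'] is. *)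
case: n IHn itn => [_ /= rd|n IHn]; first by rewrite rd cd' in ncr.
rewrite iterSr {2}/contour ifT; first exact: IHn.
by move/negbT: ncr; rewrite /cut_dart src_rot // Bd negbK.
Qed.

Fact left_face_subproof d : porbit phi (Defs.rev d) \in porbits phi.
Proof. exact: imset_f. Qed.

Definition left_face d : face r :=
  Sub (porbit phi (Defs.rev d)) (left_face_subproof d).

(** The cycle lists the left faces of the cut darts in one orbit of [next_cut]; the edge of
    [next_cut d] separates the left face of [d] from that of [next_cut d]. *)
Lemma hamiltonian_cut : 2 < #|face r| -> hamiltonian (@dual_adj G r).
Proof.
move=> F_gt2; have [A0 _] : exists A0 : face r, true.
  by have /card_gt0P[A0] := ltnW (ltnW F_gt2); exists A0.
have face_left (A : face r) : exists2 d, cut_dart d & A = left_face d.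
  case: A => A AP; have /imsetP[d _ def_A] := AP.
  have [e ce fe] := face_has_cut d; exists e => //; apply: val_inj.
  by rewrite /= def_A; apply/esym/eqP; rewrite eq_porbit_mem.
have [d0 cd0 _] := face_left A0.
pose p := fingraph.orbit next_cut d0.
have cut_p : all cut_dart p.
  apply/allP=> d; rewrite -fconnect_orbit => /iter_findex <-.
  by elim: (findex _ _ _) => //= n /next_cutP[].
have surj A : A \in map left_face p.
  have [d cd ->] := face_left A; apply: map_f.
  by rewrite -fconnect_orbit next_cut_connect.
exists (map left_face p) => //; apply/and3P; split.
- rewrite (leq_trans F_gt2) // (leq_trans _ (card_size _)) //.
  by apply: subset_leq_card; apply/subsetP.
(* The orbit closes up because [d0] can be reached again from its successor. *)
- have: fcycle next_cut p.
    by rewrite -fconnect_f next_cut_connect //; case: (next_cutP cd0).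
  rewrite cycle_map; apply: (sub_in_cycle _ cut_p) => d d' cd _ /eqP<- /=.
  have [_ nd] := next_cutP cd.
  by apply/existsP; exists (next_cut d); rewrite nd porbit_id.
- rewrite map_inj_in_uniq ?orbit_uniq // => d d'.
  move=> /(allP cut_p) cd /(allP cut_p) cd'.
  move=> /(congr1 val)/= eq_f; apply: rev_cut_unique => //.
  by rewrite -eq_f porbit_id.
Qed.

End CutCycle.

End Triangulation.

(** * The red-green subgraph of a 3-coloured triangulation *)

Definition nonblue (k : colour) : bool := if k is Blue then false else true.

Lemma nonblueP (k : colour) : nonblue k -> k = Red \/ k = Green.
Proof. by case: k; [| left | right]. Qed.

(** A triangle carries all three colours, so the corners other than a non-blue [x] are one blue and
    one non-blue. *)
Lemma nonblue_opp_blue (G : sgraph) (c : G -> colour) (x y z : G) :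
  proper_colouring c -> adj x y -> adj y z -> adj z x ->
  nonblue (c x) -> nonblue (c y) = ~~ nonblue (c z).
Proof.
move=> col /col xy /col yz /col zx; move: xy yz zx.
by case: (c x); case: (c y); case: (c z).
Qed.

Section ColouredTriangulation.

Variables (G : sgraph) (r : {perm dart G}) (c : G -> colour).
Hypothesis rot_r : rotation r.
Hypothesis tri_r : forall d, size (face_boundary r d) = 3.
Hypothesis col_c : proper_colouring c.

Local Notation rg := [set x : G | nonblue (c x)].

Lemma nonblue_neighbours x : nonblue (c x) -> deg x = 4 ->
  #|[set w in rg | adj x w]| <= 2.
Proof.
move=> nbx deg_x; set N := [set w in rg | adj x w].
pose D := [set d : dart G | src d == x].
pose D1 := [set d in D | nonblue (c (tgt d))].
have injD : {in D &, injective (@tgt G)}.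
  move=> d d'; rewrite !inE => /eqP dx /eqP d'x.
  by apply: dart_inj; rewrite dx d'x.
have sD1D : {subset D1 <= D} by move=> d; rewrite inE => /andP[].
have cardD : #|D| = 4.
  rewrite -(card_in_imset injD) -deg_x; apply: eq_card => w; rewrite !inE.
  apply/imsetP/idP => [[d]|/dart_of_adj[d [dx dw]]].
    by rewrite inE => /eqP<- ->; apply: adj_dart.
  by exists d; rewrite ?inE ?dx.
have cardN : #|N| = #|D1|.
  rewrite -(card_in_imset (sub_in2 sD1D injD)); apply: eq_card => w; rewrite !inE.
  apply/idP/imsetP => [/andP[nbw /dart_of_adj[d [dx dw]]]|[d]].
    by exists d; rewrite ?inE ?dx ?dw ?eqxx.
  by rewrite !inE => /andP[/eqP<- nbd] ->; rewrite nbd adj_dart.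
(* Colours alternate around [x], so [r] injects the darts towards non-blue vertices into the
   remaining ones: at most half of the four are in [D1]. *)
have rD1 : r @: D1 \subset D :\: D1.
  apply/subsetP=> _ /imsetP[d + ->]; rewrite !inE src_rot //.
  case/andP=> /eqP dx nbd; rewrite dx eqxx andbT /=.
  rewrite (@nonblue_opp_blue G c x (tgt d) (tgt (r d))) // in nbd.
  - by rewrite -dx adj_dart.
  - by rewrite adj_sym adj_tgt_rot.
  - by rewrite -dx -(src_rot rot_r) adj_sym adj_dart.
have := subset_leq_card rD1; rewrite (card_imset _ perm_inj) cardsD.
rewrite (setIidPr _) ?cardD ?cardN; last by apply/subsetP.
by lia.
Qed.

(* A path through a blue vertex b is rerouted along the link of b. *)
Lemma nonblue_connected : (forall x y : G, connect (@adj G) x y) ->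
  connected_set rg.
Proof.
move=> conG.
have link b y z : ~~ nonblue (c b) -> adj b y -> adj b z ->
    connect (induced rg) y z.
  move=> nb /dart_of_adj[d [db <-]] /dart_of_adj[d' [d'b <-]].
  have [n ->] := same_src_iter rot_r (etrans db (esym d'b)).
  elim: n => [|n IHn]; first exact: connect0.
  apply: connect_trans IHn (connect1 _); rewrite iterS; set e := iter n r d.
  have eb : src e = b by rewrite src_iter_rot.
  have nbb z0 : adj b z0 -> nonblue (c z0).
    by move/col_c; case: (c b) nb => // _; case: (c z0).
  rewrite /induced /= !inE adj_sym adj_tgt_rot // !nbb // -eb ?adj_dart //.
  by rewrite -(src_rot rot_r) adj_dart.
(* The start [v] stands in for [w]: it is [w] itself when [w] is non-blue, and an arbitrary
   neighbour of [w] when [w] is blue. *)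
have walk p w : path (@adj G) w p -> nonblue (c (last w p)) ->
    forall v, (if nonblue (c w) then v = w else adj w v) ->
    connect (induced rg) v (last w p).
  elim: p w => [|w' p IHp] w /=; first by move=> _ -> v ->; apply: connect0.
  case/andP=> ww' w'p nb_last v; have {}IHp := IHp w' w'p nb_last.
  have [nbw ->|nbw wv] := boolP (nonblue (c w)).
    have [nbw'|nbw'] := boolP (nonblue (c w')).
      rewrite nbw' in IHp; apply: connect_trans (IHp _ (erefl _)).
      by apply: connect1; rewrite /induced /= !inE nbw nbw'.
    by apply: IHp; rewrite (negPf nbw') adj_sym.
  have nbw' : nonblue (c w').
    by move/col_c: ww'; case: (c w) nbw => // _; case: (c w').
  rewrite nbw' in IHp.
  exact: connect_trans (link _ _ _ nbw wv ww') (IHp _ (erefl _)).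
move=> u v; rewrite !inE => nbu nbv; have /connectP[p up def_v] := conG u v.
by rewrite def_v; apply: walk; rewrite -?def_v ?nbu.
Qed.

End ColouredTriangulation.

Theorem corollary2 (G : sgraph) (r : {perm dart G}) (c : G -> colour)
  (Htri : planar_triangulation r)
  (Heul : eulerian G)
  (Hcol : proper_colouring c)
  (Hcyc : forall s : seq G, is_cycle (@adj G) s ->
     (forall x : G, x \in s -> c x = Red \/ c x = Green) ->
     exists2 x : G, x \in s & deg x = 4) :
  hamiltonian (@dual_adj G r).
Proof.
case: Htri => G_gt3 [rot_r conG euler] face3.
have tri_r d : size (face_boundary r d) = 3 by case: (face3 d).
set rg := [set x : G | nonblue (c x)].
(* Vertex covers of the red-green subgraph; they will meet every face, since each face has a
   red-green side. *)
pose cover (B : {set G}) := [forall x in rg, forall y in rg,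
  adj x y ==> (x \in B) || (y \in B)].
pose good (B : {set G}) := [&& B \subset rg, cover B &
  [forall u in B, forall v in B, connect (induced B) u v]].
have good_rg : good rg.
  apply/and3P; split=> //; last exact/connected_setP/(nonblue_connected rot_r).
  by apply/forall_inP=> x rgx; apply/forall_inP=> y _; rewrite rgx implybT.
have [B /minsetP[/and3P[sB covB conB] minB]] : {B | minset good B}.
  by apply: ex_minset; exists rg.
move/connected_setP: conB => conB.
have coverP x y : adj x y -> nonblue (c x) -> nonblue (c y) ->
    (x \in B) || (y \in B).
  move=> xy nbx nby; have rgx : x \in rg by rewrite inE.
  by have := forall_inP (forall_inP covB x rgx) y; rewrite inE xy; apply.
have acB : acyclic_set B.
  move=> s s_cyc ssB.
  have [x sx deg_x] : exists2 x, x \in s & deg x = 4.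
    by apply: Hcyc => // x /ssB/(subsetP sB); rewrite inE => /nonblueP.
  have Bx := ssB x sx; have rgx := subsetP sB x Bx.
  have nbx : nonblue (c x) by rewrite inE in rgx.
  have [/subsetP Nx conBx] := connected_set_remove conB sB s_cyc ssB sx
    (nonblue_neighbours rot_r tri_r Hcol nbx deg_x).
  (* All non-blue neighbours of [x] lie on the cycle, hence in [B], so they cover the red-green
     edges at [x] once [x] is gone. *)
  have Nx_B y : y \in rg -> adj x y -> y \in B :\ x.
    move=> rgy xy; rewrite !inE ssB ?andbT; last by rewrite Nx // inE rgy.
    by apply: contraTneq xy => ->; rewrite adj_irr.
  have good_Bx : good (B :\ x).
    rewrite /good (subset_trans (subsetDl _ _) sB).
    apply/andP; split=> //; apply/andP; split; last exact/connected_setP.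
    apply/forall_inP=> y rgy; apply/forall_inP=> z rgz; apply/implyP=> yz.
    have [yx|nyx] := eqVneq y x; first by rewrite orbC Nx_B // -yx.
    have [zx|nzx] := eqVneq z x; first by rewrite Nx_B // -zx adj_sym.
    by move: rgy rgz; rewrite !inE nyx nzx => nby nbz; apply: coverP.
  by move: Bx; rewrite -(minB _ good_Bx (subsetDl _ _)) !inE eqxx.
have adj_face d : [/\ adj (src d) (tgt d), adj (tgt d) (tgt (face_perm r d))
                    & adj (tgt (face_perm r d)) (src d)].
  rewrite adj_dart adj_src_tgt_face //.
  by rewrite -{1}(src_face_perm rot_r) adj_dart.
have blueB x : x \in B -> c x <> Blue.
  by move/(subsetP sB); rewrite inE; case: (c x).
apply: (hamiltonian_cut rot_r tri_r (B := B)) => [d|d||].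
(* The three corners have different colours, and [B] covers the side joining the red corner to the
   green one. *)
- have [ab bc ca] := adj_face d.
  move: (Hcol _ _ ab) (Hcol _ _ bc) (Hcol _ _ ca).
  move: (coverP _ _ ab) (coverP _ _ bc) (coverP _ _ ca).
  case: (c (src d)); case: (c (tgt d)); case: (c (tgt _)) => // h1 h2 h3 _ _ _;
    first [ case/orP: (h1 isT isT) | case/orP: (h2 isT isT)
          | case/orP: (h3 isT isT) ];
    by move=> ->; rewrite ?orbT.
(* Were all three corners in [B], none would be blue, and two colours do not suffice for a
   triangle. *)
- have [ab bc ca] := adj_face d; rewrite -!negb_and; apply/negP=> /and3P[].
  move=> /blueB + /blueB + /blueB.
  move: (Hcol _ _ ab) (Hcol _ _ bc) (Hcol _ _ ca).
  by case: (c (src d)); case: (c (tgt d)); case: (c (tgt _)).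
- exact: one_contour_tree.
- exact: two_lt_faces.
Qed.
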